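(* A left cancellative $(n-1)$-translatable semigroup of order $n$ is isomorphic to the additive group $\mathbb{Z}_n$.
   Context: A groupoid is a set with a binary operation $\cdot$; a semigroup is an associative groupoid. It is left cancellative if $x\cdot y=x\cdot z$ implies $y=z$. $\mathbb{Z}_n$ is the additive group of integers modulo $n$. For an integer $x$, $[x]_n$ denotes the residue of $x$ modulo $n$, represented in $\{1,\ldots,n\}$, with $0$ identified with $n$. All groupoids are finite and taken to be of the form $Q=\{1,\ldots,n\}$ with the natural ordering. For $1\le k<n$, $Q$ is $k$-translatable if in its multiplication table each row $i$, $2\le i\le n$, is obtained from row $i-1$ by cyclically shifting it $k$ places to the right, i.e. $i\cdot j=(i-1)\cdot[j-k]_n$ for all $j$ and all $2\le i\le n$. *)

(* Defs.v *)
From HB Require Import structures.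
From mathcomp Require Import all_boot all_order all_algebra.
Set Implicit Arguments.
Unset Strict Implicit.
Unset Printing Implicit Defensive.
Import GRing.Theory.

Definition carrier (n : nat) : Type := {i : nat | 1 <= i <= n}.

(* The residue [x]_n taken in {1, ..., n}: multiples of n are sent to n. *)
Definition residue (n : nat) (x : int) : nat :=
  if (n%:Z %| x)%Z then n else `|(x %% n%:Z)%Z|%N.

(* Row i equals row i - 1 shifted k places to the right, for 2 <= i <= n: here
   i' = i - 1 and j' = [j - k]_n.  Since i' : carrier n, the equation
   i = i' + 1 already forces 2 <= i. *)
Definition translatable (n k : nat) (op : carrier n -> carrier n -> carrier n)
    : Prop :=
  1 <= k < n /\
  forall i i' j j' : carrier n,
    val i = (val i').+1 ->
    val j' = residue n ((val j)%:Z - k%:Z)%R ->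
    op i j = op i' j'.

Definition left_cancellative (T : Type) (op : T -> T -> T) : Prop :=
  forall x y z : T, op x y = op x z -> y = z.

Definition isomorphic (S T : Type) (opS : S -> S -> S) (opT : T -> T -> T)
    : Prop :=
  exists2 f : S -> T, bijective f & {morph f : x y / opS x y >-> opT x y}.

(* Main.v *)
Require Import Defs.
From HB Require Import structures.
From mathcomp Require Import all_boot all_order all_algebra.
Set Implicit Arguments.
Unset Strict Implicit.
Unset Printing Implicit Defensive.
Import GRing.Theory.

(** Since [-(n - 1)] is [1] modulo [n], each row of an [(n - 1)]-translatable
    table is the previous one read one place further, so that
    [i * j = (i - 1) * (j + 1)]: the product depends only on the class of
    [i + j] modulo [n] ([translatable_prod]).  Identifying the carrier with
    the integers modulo [n], the product becomes [b (x + y)] for some map [b],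
    and left cancellation says that [b] is injective.  Associativity then reads
    [b (b (x + y) + z) = b (x + b (y + z))]; cancelling [b] and setting
    [x = y = 0] shows that [b] is the translation by [c = b 0]
    ([assoc_of_sum_translation]).  Hence the product is [x + y + c], and
    translation by [c] is an isomorphism from it onto addition. *)

Local Open Scope ring_scope.

Lemma assoc_of_sum_translation (V : zmodType) (b : V -> V) :
    injective b -> associative (fun x y => b (x + y)) ->
  forall z, b z = z + b 0.
Proof.
move=> b_inj b_assoc z.
by have /b_inj := b_assoc 0 0 z; rewrite !add0r addrC => <-.
Qed.

Section Residues.

Variable n : nat.
Hypothesis n_gt1 : (1 < n)%N.

Definition cls (x : carrier n) : 'Z_n := (val x)%:R.

Lemma residue_bounds (x : int) : (1 <= residue n x <= n)%N.
Proof.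
have n_neq0 : n%:Z != 0 by rewrite -lt0n ltnW.
rewrite /residue; case: dvdz_mod0P => [_ | /eqP r_neq0].
  by rewrite leqnn ltnW.
rewrite absz_gt0 r_neq0 /= ltnW // -ltz_nat gez0_abs ?modz_ge0 //.
by rewrite ltz_pmod // ltz_nat ltnW.
Qed.

Definition repr_of (x : int) : carrier n :=
  exist (fun i => 1 <= i <= n)%N _ (residue_bounds x).

Lemma cls_repr_of (x : int) : cls (repr_of x) = x%:~R.
Proof.
have n_neq0 : n%:Z != 0 by rewrite -lt0n ltnW.
rewrite /cls /= /residue [in RHS](divz_eq x n%:Z) intrD intrM -pmulrn.
rewrite pchar_Zp // mulr0 add0r.
case: ifP => [/dvdz_mod0P -> | _]; first by rewrite pchar_Zp.
by rewrite pmulrn gez0_abs ?modz_ge0.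
Qed.

(** The range [1 .. n] contains exactly one multiple of [n], namely [n], so the
    only case beyond comparing remainders is that of the representative [n]. *)
Lemma cls_inj : injective cls.
Proof.
case=> [x x_bnd] [y y_bnd] /(congr1 val).
rewrite /cls /= !val_Zp_nat // => eq_xy; apply: val_inj => /=.
case/andP: x_bnd => x_gt0; rewrite leq_eqVlt => /predU1P[xn | x_lt];
case/andP: y_bnd => y_gt0; rewrite leq_eqVlt => /predU1P[yn | y_lt].
- by rewrite xn yn.
- by move: eq_xy y_gt0; rewrite xn modnn modn_small // => <-.
- by move: eq_xy x_gt0; rewrite yn modnn modn_small // => ->.
- by rewrite !modn_small in eq_xy.
Qed.

Definition of_cls (z : 'Z_n) : carrier n := repr_of (z : nat)%:Z.

Lemma of_clsK : cancel of_cls cls.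
Proof. by move=> z; rewrite cls_repr_of -[LHS]/(z%:R) natr_Zp. Qed.

Lemma clsK : cancel cls of_cls.
Proof. by move=> x; apply: cls_inj; rewrite of_clsK. Qed.

(** Descending from row [i] to row [1] moves the column forward by [i - 1], so
    every product can be read off the first row. *)
Lemma translatable_prod (op : carrier n -> carrier n -> carrier n) :
    translatable (n - 1) op ->
  forall i j, op i j = op (of_cls 1) (of_cls (cls i + cls j - 1)).
Proof.
case=> _ shift [i i_bnd]; elim: i i_bnd => [|[|i] IHi] // i_bnd j.
  have -> : exist (fun k => 1 <= k <= n)%N _ i_bnd = of_cls 1 :> carrier n.
    by apply: cls_inj; rewrite of_clsK.
  by rewrite of_clsK addrC addKr clsK.
have i'_bnd : (1 <= i.+1 <= n)%N by case/andP: i_bnd => _ /ltnW.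
set j' := repr_of ((val j)%:Z - (n - 1)%N%:Z).
pose i' : carrier n := exist (fun k => 1 <= k <= n)%N _ i'_bnd.
rewrite (shift _ i' j j') // IHi; congr (op _ (of_cls _)).
have -> : cls j' = cls j + 1.
  rewrite cls_repr_of intrB -!pmulrn.
  by rewrite natrB ?pchar_Zp // ?sub0r ?opprK // ltnW.
by rewrite /cls /= [i.+2%:R]mulrS [1 + _]addrC -!addrA [1 + (_ - 1)]addrCA.
Qed.

End Residues.

Local Close Scope ring_scope.

(* 'Z_n is the ring of integers modulo n only when 1 < n; this is part of
   translatable, which requires 1 <= n - 1. *)
Theorem corollary5p9 (n : nat) (op : carrier n -> carrier n -> carrier n)
    (op_assoc : associative op)
    (op_lcancel : left_cancellative op)
    (op_transl : translatable (n - 1) op) :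
  isomorphic op (fun x y : 'Z_n => (x + y)%R).
Proof.
have n_gt1 : 1 < n by case: op_transl => /andP[]; rewrite subn_gt0.
have opE := translatable_prod n_gt1 op_transl.
pose b (z : 'Z_n) : 'Z_n := cls (op (of_cls n_gt1 1%R) (of_cls n_gt1 (z - 1)%R)).
have cls_op x y : cls (op x y) = b (cls x + cls y)%R by rewrite opE.
have b_inj : injective b.
  move=> u v /(cls_inj n_gt1) /op_lcancel /(can_inj (of_clsK n_gt1)).
  exact: addIr.
have b_assoc : associative (fun x y => b (x + y)%R).
  move=> x y z; rewrite -(of_clsK n_gt1 x) -(of_clsK n_gt1 y).
  by rewrite -(of_clsK n_gt1 z) -!cls_op op_assoc.
have bE := assoc_of_sum_translation b_inj b_assoc.
exists (fun x => cls x + b 0)%R => [|x y].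
  exists (fun z => of_cls n_gt1 (z - b 0)%R) => [x | z].
    by rewrite addrK clsK.
  by rewrite of_clsK subrK.
by rewrite cls_op bE addrACA addrA.
Qed.
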